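(* Consider a Stackelberg network pricing game with $k\ge 1$ followers as described in the context, and let $r^*$ be the maximum total revenue achievable by the leader. For any $\varepsilon>0$, the single-price algorithm computes a price function whose total revenue $r$ satisfies $(1+\varepsilon)(H_k+H_m)\cdot r\ge r^*$, where $H_n=\sum_{j=1}^n 1/j$.
   Context: A Stackelberg network pricing game (edge game): multigraph $G=(V,E)$, $E=E_p\cup E_f$ disjoint; fixed costs $c(e)\ge 0$ for $e\in E_f$; leader chooses prices $p(e)\ge 0$ for $e\in E_p$; $m=|E_p|$. Followers $i=1,\dots,k$ each have a collection $\mathcal{S}_i\subseteq 2^E$ of feasible subnetworks, at least one of which contains only fixed-price edges. The weight of $S$ is $w(S)=\sum_{e\in S\cap E_f}c(e)+\sum_{e\in S\cap E_p}p(e)$ and its revenue is $r(S)=\sum_{e\in S\cap E_p}p(e)$. Each follower $i$ chooses a minimum-weight $S_i^*(p)\in\mathcal{S}_i$ (computable in polynomial time for any prices), breaking ties in favor of higher revenue. The leader's total revenue is $\sum_{i=1}^k r(S_i^*(p))$. The single-price algorithm tries, for $j=0,1,2,\dots$ up to a logarithmic bound determined by the fixed costs (so that the tested prices reach the largest cost $c_0$ of a cheapest fixed-edge-only feasible subnetwork of any follower), the assignment of the same price $(1+\varepsilon)^j$ to all priceable edges, and returns the one with maximum total revenue.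
   Formalization: Added assumption: the unit of money is small enough that every uniform price below 1 is matched in total revenue by some uniform price at least 1; without it the claim fails (one follower, a fixed edge of cost 1 against a path of two priceable edges). *)

(* Defs.v *)
From HB Require Import structures.
From mathcomp Require Import all_boot all_order all_algebra.
From mathcomp Require Import reals exp.

Set Implicit Arguments.
Unset Strict Implicit.
Unset Printing Implicit Defensive.

Import Order.TTheory GRing.Theory Num.Theory.

Local Open Scope ring_scope.

(* The fixed-price edges are the complement of [priceable]; values of [cost]
   on priceable edges are never used. *)
Record pricing_game (R : realType) (V E : finType) (k : nat) := PricingGame {
  ends : E -> V * V;
  priceable : {set E};
  cost : E -> R;
  feasible : 'I_k -> {set {set E}};
  cost_ge0 : forall e, e \notin priceable -> 0 <= cost e;
  feasible_fixed :
    forall i, exists2 S, S \in feasible i & S \subset ~: priceable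
}.

Section Game.
Variables (R : realType) (V E : finType) (k : nat).
Variable G : pricing_game R V E k.

Definition fixed_edges : {set E} := ~: priceable G.

Definition fixed_cost (S : {set E}) : R :=
  \sum_(e in S :&: fixed_edges) cost G e.

(* A price function is a map on all edges, read only on priceable ones. *)
Definition valid_pricing (p : E -> R) : Prop :=
  forall e, e \in priceable G -> 0 <= p e.

Definition revenue (p : E -> R) (S : {set E}) : R :=
  \sum_(e in S :&: priceable G) p e.

Definition weight (p : E -> R) (S : {set E}) : R :=
  fixed_cost S + revenue p S.

Definition best_response (p : E -> R) (i : 'I_k) (S : {set E}) : Prop :=
  [/\ S \in feasible G i,
      forall T, T \in feasible G i -> weight p S <= weight p T
    & forall T, T \in feasible G i -> weight p T = weight p S ->
        revenue p T <= revenue p S].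

(* [choice p i] is the subnetwork bought by follower [i] under prices [p];
   ties that remain after comparing revenues are broken arbitrarily. *)
Definition follower_choice (choice : (E -> R) -> 'I_k -> {set E}) : Prop :=
  forall p, valid_pricing p -> forall i, best_response p i (choice p i).

Variable choice : (E -> R) -> 'I_k -> {set E}.

Definition total_revenue (p : E -> R) : R :=
  \sum_(i < k) revenue p (choice p i).

Definition max_revenue (rstar : R) : Prop :=
  (exists2 p, valid_pricing p & total_revenue p = rstar) /\
  (forall p, valid_pricing p -> total_revenue p <= rstar).

(* The unit [fixed_cost fixed_edges] bounds every term from above, and some
   term exists by [feasible_fixed], so this is the minimum of the terms. *)
Definition fixed_opt (i : 'I_k) : R :=
  \big[Num.min/fixed_cost fixed_edges]_(S in feasible G i
    | S \subset fixed_edges) fixed_cost S.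

(* All [fixed_opt i] are nonnegative. *)
Definition c0 : R := \big[Num.max/0]_(i < k) fixed_opt i.

Definition uniform_price (t : R) : E -> R := fun=> t.

(* Last tested exponent: the ceiling of the logarithm of c0 in base 1 + eps,
   or 0 when that is negative. *)
Definition last_exponent (eps : R) : nat :=
  absz (Num.max 0 (Num.ceil (ln c0 / ln (1 + eps)))).

Definition single_price (eps : R) : E -> R :=
  uniform_price ((1 + eps) ^+
    [arg max_(j > (ord0 : 'I_(last_exponent eps).+1))
       total_revenue (uniform_price ((1 + eps) ^+ j))]%O).

(* Normalization of the unit of money.  The algorithm tests no price below
   (1 + eps) ^+ 0 = 1, so the unit must be small enough that uniform prices
   below 1 are not needed.  Without this the guarantee fails: for one follower
   choosing between a fixed edge of cost 1 and a path of two priceable edges,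
   prices 1/2 earn 1 while the only tested price, 1, earns 0.  Since a game has
   finitely many threshold prices, choosing a smaller unit always achieves it. *)
Definition normalized_unit : Prop :=
  forall t, 0 < t < 1 -> exists2 t', 1 <= t' &
    total_revenue (uniform_price t) <= total_revenue (uniform_price t').

End Game.

Definition harmonic_number (R : realType) (n : nat) : R :=
  \sum_(1 <= j < n.+1) j%:R^-1.

(* Main.v *)
(* Let B(t) be the total weight paid by the followers under the uniform price
   t, and N(t) the number of priceable edges they buy.  Each follower minimizes
   over affine functions of t, so B is concave with supergradient N, and
   N <= km is nonincreasing.  Under arbitrary prices a follower never pays more
   than a cheapest fixed-edge-only subnetwork, and the fixed part of the payment
   is at least the minimum at price 0; hence r* <= B(t) - B(0) as soon as
   N(t) = 0.  If t N(t) < M for all t > 0, then N(M / j) < j, and telescoping B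
   over the prices M / j for j = 1, ..., km gives r* <= M H_{km}, where
   H_{km} <= H_k + H_m.  Finally, rounding a price down to a power of 1 + eps
   costs at most a factor 1 + eps because N is nonincreasing. *)
Require Import Defs.
From mathcomp Require Import all_boot all_order all_algebra.
From mathcomp Require Import reals exp.
From mathcomp Require Import ring lra.

Set Implicit Arguments.
Unset Strict Implicit.
Unset Printing Implicit Defensive.

Import Order.TTheory GRing.Theory Num.Theory.

Local Open Scope ring_scope.

Lemma harmonic_numberS (R : realType) (n : nat) :
  harmonic_number R n.+1 = harmonic_number R n + n.+1%:R^-1.
Proof. by rewrite /harmonic_number big_nat_recr. Qed.

Lemma harmonic_number_ge1 (R : realType) (n : nat) :
  (0 < n)%N -> 1 <= harmonic_number R n.
Proof.
case: n => // n _; elim: n => [|n IHn].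
  by rewrite /harmonic_number big_nat1 invr1.
by rewrite harmonic_numberS (le_trans IHn)// lerDl invr_ge0.
Qed.

Lemma harmonic_numberD_le (R : realType) (a m : nat) :
  harmonic_number R (a + m) <= harmonic_number R a + m%:R / a.+1%:R.
Proof.
elim: m => [|m IHm]; first by rewrite addn0 mul0r addr0.
rewrite addnS harmonic_numberS -[m.+1%:R]natr1 mulrDl mul1r addrA lerD//.
by rewrite lef_pV2 ?posrE// ler_nat ltnS leq_addr.
Qed.

(* For [0 < j], each of the [m] terms of [harmonic_number (j.+1 * m)] after
   the first [j * m] is at most [(j * m).+1^-1], so they sum to at most
   [j^-1]. *)
Lemma harmonic_numberM_le (R : realType) (k m : nat) : (0 < k)%N ->
  harmonic_number R (k * m) <= harmonic_number R k + harmonic_number R m.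
Proof.
case: k => // k _; rewrite [leRHS]addrC.
(* The induction needs this stronger bound, with [k] harmonic terms against [k.+1] blocks: at
   [k = 0] it is an equality. *)
apply: (@le_trans _ _ (harmonic_number R m + harmonic_number R k)); last first.
  by rewrite harmonic_numberS lerD2l lerDl invr_ge0.
elim: k => [|k IHk].
  by rewrite mul1n lerDl /harmonic_number big_geq.
rewrite mulSn addnC (le_trans (harmonic_numberD_le _ _ _))//.
rewrite harmonic_numberS addrA lerD// ler_pdivrMr// mulrC ler_pdivlMr//.
by rewrite -natrM ler_nat mulnC leqnSn.
Qed.

Section UniformPricing.
Context {R : realType} {V E : finType} {k : nat}.
Context {G : pricing_game R V E k} {choice : (E -> R) -> 'I_k -> {set E}}.

Let buy (t : R) : 'I_k -> {set E} := choice (uniform_price t).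

Definition sold (t : R) : nat := \sum_(i < k) #|buy t i :&: priceable G|.

Definition bill (t : R) : R :=
  \sum_(i < k) weight G (uniform_price t) (buy t i).

Lemma revenue_uniform (t : R) (S : {set E}) :
  revenue G (uniform_price t) S = t * #|S :&: priceable G|%:R.
Proof. by rewrite /revenue /uniform_price sumr_const mulr_natr. Qed.

Lemma total_revenue_uniform (t : R) :
  total_revenue G choice (uniform_price t) = t * (sold t)%:R.
Proof.
rewrite /total_revenue /sold natr_sum mulr_sumr.
by apply: eq_bigr => i _; rewrite revenue_uniform.
Qed.

Lemma sold_le (t : R) : (sold t <= k * #|priceable G|)%N.
Proof.
have -> : (k * #|priceable G| = \sum_(i < k) #|priceable G|)%N.
  by rewrite sum_nat_const card_ord.
by rewrite leq_sum// => i _; rewrite subset_leq_card// subsetIr.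
Qed.

Lemma uniform_valid (t : R) : 0 <= t -> valid_pricing G (uniform_price t).
Proof. by move=> t0 e _. Qed.

Hypothesis choiceP : follower_choice G choice.

(* [bill] is an infimum of affine functions of the price, and [sold] is one
   of its supergradients. *)
Lemma bill_slope (s t : R) : 0 <= s -> 0 <= t ->
  bill t - bill s <= (sold s)%:R * (t - s).
Proof.
move=> s0 t0; rewrite /bill /sold natr_sum mulr_suml lerBlDr -big_split /=.
apply: ler_sum => i _.
(* The subnetwork bought at [s] is also an option at [t], where each of its priceable edges costs
   [t - s] more. *)
have [Ss _ _] := choiceP (uniform_valid s0) i.
have [_ /(_ _ Ss) le_ts _] := choiceP (uniform_valid t0) i.
apply: (le_trans le_ts); rewrite /weight !revenue_uniform /buy; lra.
Qed.

(** Adding [bill_slope] in both directions cancels the bills and leaves a sign condition on the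
    difference of the slopes. *)
Lemma sold_anti (s t : R) : 0 <= s -> s <= t -> (sold t <= sold s)%N.
Proof.
move=> s0; rewrite le_eqVlt => /predU1P[->//|lt_st].
have t0 : 0 <= t by rewrite (le_trans s0)// ltW.
have := lerD (bill_slope s0 t0) (bill_slope t0 s0).
rewrite -(ler_nat R) => le0; rewrite -(ler_pM2r (x := t - s)) ?subr_gt0//.
lra.
Qed.

Lemma total_revenue_le_bill (p : E -> R) (t : R) :
  valid_pricing G p -> 0 <= t -> sold t = 0%N ->
  total_revenue G choice p <= bill t - bill 0.
Proof.
move=> p_ok t0 /eqP; rewrite sum_nat_eq0 => /forallP/= sold0.
rewrite lerBrDr /total_revenue /bill -big_split ler_sum// => i _.
have [Sp le_p _] := choiceP p_ok i.
have [_ /(_ _ Sp) + _] := choiceP (uniform_valid (lexx 0)) i.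
have [St _ _] := choiceP (uniform_valid t0) i.
have := le_p _ St; rewrite /weight !revenue_uniform !mul0r !addr0.
(* As [buy t i] has only fixed edges, it weighs the same under [p] as at [t]. *)
have /eqP buy0 : buy t i :&: priceable G == set0.
  by rewrite -cards_eq0; exact: sold0.
rewrite /revenue buy0 cards0 mulr0 addr0 big_set0 addr0 -/(buy t i).
by rewrite /buy /=; lra.
Qed.

(* Between [M / j.+2] and [M / j.+1] the slope of [bill] is at most [j.+1],
   which contributes [M / j.+2]. *)
Lemma bill_harmonic (M : R) (n : nat) : 0 < M ->
  (forall t, 0 < t -> total_revenue G choice (uniform_price t) < M) ->
  bill M - bill (M / n.+1%:R) <= M * (harmonic_number R n.+1 - 1).
Proof.
move=> M0 ltM; elim: n => [|n IHn].
  by rewrite /harmonic_number big_nat1 invr1 mulr1 !subrr mulr0.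
have pos j : 0 < M / j.+1%:R :> R by rewrite divr_gt0.
have sold_n : (sold (M / n.+2%:R) <= n.+1)%N.
  have := ltM _ (pos n.+1).
  by rewrite total_revenue_uniform mulrAC ltr_pdivrMr// ltr_pM2l// ltr_nat.
have step : bill (M / n.+1%:R) - bill (M / n.+2%:R) <= M / n.+2%:R.
  apply: (le_trans (bill_slope (ltW (pos _)) (ltW (pos _)))).
  apply: (@le_trans _ _ (n.+1%:R * (M / n.+1%:R - M / n.+2%:R))).
    rewrite ler_wpM2r ?ler_nat// subr_ge0 ler_pM2l// lef_pV2 ?posrE//.
    by rewrite ler_nat.
  rewrite le_eqVlt; apply/orP; left; apply/eqP; field.
  by rewrite -natrD nat1r !pnatr_eq0.
rewrite harmonic_numberS addrAC [leRHS]mulrDr.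
have := lerD IHn step; rewrite addrA subrK; exact.
Qed.

Lemma total_revenue_le_harmonic (p : E -> R) (M : R) (n : nat) :
  valid_pricing G p -> (k * #|priceable G| <= n.+1)%N ->
  (forall t, 0 < t -> total_revenue G choice (uniform_price t) <= M) ->
  total_revenue G choice p <= harmonic_number R n.+1 * M.
Proof.
move=> p_ok le_n leM.
have M0 : 0 <= M.
  by rewrite (le_trans _ (leM 1 _))// total_revenue_uniform mul1r.
have H0 : 0 < harmonic_number R n.+1.
  by rewrite (lt_le_trans ltr01)// harmonic_number_ge1.
(* [bill_harmonic] needs a positive and strict bound on the revenue; an arbitrarily small slack [e]
   provides it. *)
rewrite mulrC -ler_pdivrMr//; apply/ler_addgt0Pr => e e0.
rewrite ler_pdivrMr//; set M' := M + e.
have M'0 : 0 < M' by rewrite ltr_wpDl.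
have ltM' t : 0 < t -> total_revenue G choice (uniform_price t) < M'.
  by move=> /leM/le_lt_trans; apply; rewrite ltrDl.
have a0 : 0 < M' / n.+1%:R by rewrite divr_gt0.
have sold0 : sold M' = 0%N.
  have := ltM' _ M'0; rewrite total_revenue_uniform -[X in _ < X]mulr1.
  by rewrite ltr_pM2l// ltrn1 ltnS leqn0 => /eqP.
apply: (le_trans (total_revenue_le_bill p_ok (ltW M'0) sold0)).
have := bill_harmonic n M'0 ltM'; rewrite [leRHS]mulrBr mulr1.
(* On the interval down to price 0 the revenue bound gives no control of the slope; the total count
   [k * #|priceable G|] does. *)
have : bill (M' / n.+1%:R) - bill 0 <= M'.
  apply: (le_trans (bill_slope (lexx 0) (ltW a0))).
  rewrite subr0 mulrCA ger_pMr// ler_pdivrMr// mul1r ler_nat.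
  exact: leq_trans (sold_le _) le_n.
lra.
Qed.

(** A follower who buys a priceable edge pays at least [t], yet no more than any feasible
    fixed-edge-only subnetwork costs. *)
Lemma sold_price_le_c0 (t : R) : 0 <= t -> (0 < sold t)%N -> t <= c0 G.
Proof.
move=> t0; rewrite lt0n sum_nat_eq0 negb_forall => /existsP[i] /=.
rewrite -lt0n => buy_gt0.
have [_ le_w _] := choiceP (uniform_valid t0) i.
have fixed_ge0 (S : {set E}) : 0 <= fixed_cost G S.
  by apply: sumr_ge0 => e; rewrite !inE => /andP[_]; exact: cost_ge0.
have fixed_weight (S : {set E}) : S \subset fixed_edges G ->
    weight G (uniform_price t) S = fixed_cost G S.
  rewrite subsets_disjoint setCK -setI_eq0 => /eqP Sp.
  by rewrite /weight revenue_uniform Sp cards0 mulr0 addr0.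
have le_t : t <= weight G (uniform_price t) (buy t i).
  rewrite /weight revenue_uniform ler_wpDl//.
  by rewrite ler_peMr// ler1n.
apply: (le_trans le_t); apply: bigmax_sup (erefl true) _.
apply: le_bigmin => [|S /andP[/le_w le_wS /fixed_weight <-]//].
(* This is the default value of the minimum, the cost of all fixed edges, which dominates that of
   [S]. *)
have [S /le_w le_wS Sf] := feasible_fixed G i.
rewrite (le_trans le_wS)// fixed_weight// /fixed_cost (setIidPl Sf) setIid.
rewrite [leRHS](big_setID S)/= (setIidPr Sf) lerDl sumr_ge0// => e.
by rewrite !inE => /andP[_]; exact: cost_ge0.
Qed.

(** The exponent is the integer part of the logarithm of [t] in base [1 + eps]; [t <= c0 G] keeps it
    in the tested range. *)
Lemma tested_price (t eps : R) : 0 < eps -> 1 <= t -> t <= c0 G ->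
  exists2 j : 'I_(last_exponent G eps).+1,
    (1 + eps) ^+ j <= t & t < (1 + eps) ^+ j.+1.
Proof.
move=> eps0 t1 tc.
have b1 : 1 < 1 + eps by rewrite ltrDl.
have b0 : 0 < 1 + eps by rewrite (lt_trans ltr01).
have t0 : 0 < t by rewrite (lt_le_trans ltr01).
have lnb : 0 < ln (1 + eps) by rewrite ln_gt0.
set x := ln t / ln (1 + eps).
have x0 : 0 <= x by rewrite divr_ge0 ?ln_ge0// ltW.
have /andP[le_x lt_x] := truncn_itv x0.
have xc : x <= ln (c0 G) / ln (1 + eps).
  by rewrite ler_pM2r ?invr_gt0// ler_ln// posrE (lt_le_trans t0).
have j_ok : (Num.trunc x < (last_exponent G eps).+1)%N.
  rewrite ltnS -(ler_nat R) (le_trans le_x)// (le_trans xc)//.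
  rewrite /last_exponent pmulrn gez0_abs ?le_max ?lexx//.
  by rewrite (le_trans (ceil_ge _))// ler_int le_max lexx orbT.
exists (Ordinal j_ok) => /=.
  rewrite -ler_ln ?posrE ?exprn_gt0// lnXn// -mulr_natl.
  by rewrite -ler_pdivlMr.
rewrite -ltr_ln ?posrE ?exprn_gt0// lnXn// -mulr_natl.
by rewrite -ltr_pdivrMr.
Qed.

Lemma single_price_revenue (t eps : R) : 0 < eps -> 1 <= t ->
  total_revenue G choice (uniform_price t) <=
  (1 + eps) * total_revenue G choice (single_price G choice eps).
Proof.
move=> eps0 t1; rewrite /single_price.
have b0 : 0 < 1 + eps by rewrite ltr_wpDl.
have t0 : 0 <= t by rewrite (le_trans ler01).
case: arg_maxP => // j _ max_j; rewrite total_revenue_uniform.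
(* A price above [c0 G] may lie beyond the tested range, but then nothing is sold and the bound is
   trivial. *)
have [s0|s0] := posnP (sold t).
  rewrite s0 mulr0 mulr_ge0 ?(ltW b0)// total_revenue_uniform.
  by rewrite mulr_ge0 ?exprn_ge0 ?(ltW b0).
have [i le_i lt_i] := tested_price eps0 t1 (sold_price_le_c0 t0 s0).
apply: (@le_trans _ _ ((1 + eps) ^+ i.+1 * (sold ((1 + eps) ^+ i))%:R)).
  rewrite ler_pM// ?(ltW lt_i)// ler_nat sold_anti// exprn_ge0//.
  exact: ltW.
rewrite exprS -mulrA -total_revenue_uniform ler_pM2l//.
exact: max_j.
Qed.

End UniformPricing.

Theorem theorem3p1 (R : realType) (V E : finType) (k : nat) (hk : (1 <= k)%N)
    (G : pricing_game R V E k)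
    (choice : (E -> R) -> 'I_k -> {set E}) (hchoice : follower_choice G choice)
    (hunit : normalized_unit G choice)
    (rstar : R) (hrstar : max_revenue G choice rstar)
    (eps : R) (heps : 0 < eps) :
  let p := single_price G choice eps in
  valid_pricing G p /\
  rstar <= (1 + eps) *
    (harmonic_number R k + harmonic_number R #|priceable G|) *
    total_revenue G choice p.
Proof.
move=> p; have b0 : 0 <= 1 + eps by rewrite addr_ge0// ltW.
have p_ok : valid_pricing G p by apply: uniform_valid; rewrite exprn_ge0.
split=> //; have [[q q_ok <-] _] := hrstar.
set M := (1 + eps) * total_revenue G choice p.
have leM t : 0 < t -> total_revenue G choice (uniform_price t) <= M.
  (* Prices below 1 cannot be rounded down to a tested one; [hunit] trades them for a price of at
     least 1. *)
  move=> t0; have [t1|t1] := leP 1 t; first exact: single_price_revenue.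
  have [|t' t'1 le_t] := hunit t; first by rewrite t0.
  exact: le_trans le_t (single_price_revenue hchoice heps t'1).
have M0 : 0 <= M.
  by rewrite (le_trans _ (leM 1 _))// total_revenue_uniform mul1r.
have [n le_n Hn] : exists2 n, (k * #|priceable G| <= n.+1)%N &
    harmonic_number R n.+1 <=
    harmonic_number R k + harmonic_number R #|priceable G|.
  (* Without priceable edges the product is 0 but the index must be positive; 1 works because [k] is
     at least 1. *)
  have [->|m0] := posnP #|priceable G|.
    exists 0%N; rewrite ?muln0//.
    rewrite {1 3}/harmonic_number big_nat1 big_geq// invr1 addr0.
    exact: harmonic_number_ge1.
  exists (k * #|priceable G|).-1; rewrite prednK ?muln_gt0 ?hk//.
  exact: harmonic_numberM_le.
apply: (le_trans (total_revenue_le_harmonic hchoice q_ok le_n leM)).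
by rewrite mulrAC [leRHS]mulrC ler_wpM2r.
Qed.
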